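(* Let $n\ge 0$ be an integer, let $a_0,a_1,\ldots,a_n,z$ be independent commuting variables, and for $0\le i\le n$ put $$a_i'=\sum_{j=0}^{i}\binom{i}{j}a_{i-j}z^j = a_i+\binom{i}{1}a_{i-1}z+\binom{i}{2}a_{i-2}z^2+\cdots+a_0z^i .$$ Let $D$ be the differential operator $$D=a_0\frac{\partial}{\partial a_1}+2a_1\frac{\partial}{\partial a_2}+3a_2\frac{\partial}{\partial a_3}+\cdots+na_{n-1}\frac{\partial}{\partial a_n}.$$ Then for any polynomial $I(a_0,a_1,\ldots,a_n)$ with rational coefficients, $$I(a_0',a_1',\ldots,a_n')=\sum_{i\ge 0}D^iI(a_0,a_1,\ldots,a_n)\,\frac{z^i}{i!}.$$
   Context: The identity is between polynomials in $a_0,\ldots,a_n,z$ with rational coefficients. $D^i$ denotes the $i$-fold iterate of $D$ acting on polynomials in $a_0,\ldots,a_n$ (with $D^0$ the identity, and $D=0$ when $n=0$). The operator $D$ preserves the degree of a monomial $a_0^{\nu_0}a_1^{\nu_1}\cdots a_n^{\nu_n}$ and lowers its weight $\nu_1+2\nu_2+\cdots+n\nu_n$ by one, so for a given $I$ only finitely many terms of the sum are nonzero. The $a_i'$ are the coefficients obtained from the binary form $f(x,y)=\sum_{i=0}^n\binom{n}{i}a_ix^{n-i}y^i$ by the shear transformation $x=x'+zy'$, $y=y'$, written as $\sum_{i=0}^n\binom{n}{i}a_i'x'^{\,n-i}y'^{\,i}$. *)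

(* Defs.v *)
From mathcomp Require Export all_boot all_order all_algebra.
From mathcomp.multinomials Require Export mpoly.

Set Implicit Arguments.
Unset Strict Implicit.
Unset Printing Implicit Defensive.

Import GRing.Theory.
Local Open Scope ring_scope.

(* Polynomials in a_0, ..., a_n are {mpoly rat[n.+1]}.  Polynomials in
   a_0, ..., a_n, z are {mpoly rat[n.+2]}: the first n.+1 variables are the
   a_i and the last one is z, so that the inclusion of the former ring in the
   latter is mwiden. *)

Definition avar (n : nat) (i : 'I_n.+1) : {mpoly rat[n.+2]} :=
  'X_(widen_ord (leqnSn n.+1) i).

Definition zvar (n : nat) : {mpoly rat[n.+2]} := 'X_ord_max.

(* The truncated subtraction and inord are harmless: j <= i < n.+1. *)
Definition ashear (n : nat) (i : 'I_n.+1) : {mpoly rat[n.+2]} :=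
  \sum_(j < i.+1) 'C(i, j)%:R *: (avar (inord (i - j) : 'I_n.+1) * zvar n ^+ j).

(* The index i < n stands for the term (i+1) a_i d/da_(i+1). *)
Definition D (n : nat) (p : {mpoly rat[n.+1]}) : {mpoly rat[n.+1]} :=
  \sum_(i < n)
    i.+1%:R *: ('X_(widen_ord (leqnSn n) i) * p^`M(lift ord0 i)).

(* Main.v *)
From HB Require Import structures.
Require Import Defs.
Import GRing.Theory.
Local Open Scope ring_scope.

Set Implicit Arguments.
Unset Strict Implicit.
Unset Printing Implicit Defensive.

(** Substituting [a'] for [a] is the time-[z] flow of the vector field [D],
    and the theorem is the Taylor expansion [exp (z D)] of that flow.  The
    expansion is kept as a polynomial [q] in a new variable [t] (the role of
    [z]) with coefficients in the polynomials in [a_0, ..., a_n], and is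
    characterised by the differential equation [dq/dt = D q] with initial value
    [q(0) = I], where [D] acts coefficientwise.  Comparing coefficients, the
    equation says that [D q_k = (k+1) q_(k+1)], whence [q_k = D^k I / k!]
    ([flow_coef]); as [q] has finite degree, [D] is nilpotent on [I].

    It remains to find, for every [I], a solution [q] whose value at [t = z] is
    [I(a')].  Evaluation is a ring morphism, and since [D] is a derivation the
    solutions of the equation form a subring ([flowD], [flowM]); so it is
    enough to find one for the constants, where [q] is constant, and for the
    variables, where [q = sum_k binom(i,k) a_(i-k) t^k] is the polynomial
    defining [a_i'] and the equation reduces to
    [(i-k) binom(i,k) = (k+1) binom(i,k+1)] ([flow_shear_poly]). *)

(** * The flow equation of a derivation *)

Definition derivation (R : nzRingType) (d : R -> R) :=
  forall p q, d (p * q) = d p * q + p * d q.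

Definition flow (R : nzRingType) (d : R -> R) (q : {poly R}) :=
  q^`() = map_poly d q.

Section Flow.

Variables (R : nzRingType) (d : {additive R -> R}).

Lemma flowP (q : {poly R}) :
  flow d q <-> forall k, d q`_k = q`_k.+1 *+ k.+1.
Proof.
split=> [eq_q k | eq_q]; first by rewrite -coef_map -eq_q coef_deriv.
by apply/polyP => k; rewrite coef_map eq_q coef_deriv.
Qed.

Lemma flow_coef (q : {poly R}) :
  flow d q -> forall k, iter k d q`_0 = q`_k *+ k`!.
Proof.
move=> /flowP eq_q; elim=> [|k IHk]; first by rewrite mulr1n.
by rewrite iterS IHk raddfMn eq_q -mulrnA factS.
Qed.

Lemma flowD (p q : {poly R}) : flow d p -> flow d q -> flow d (p + q).
Proof. by rewrite /flow derivD raddfD => -> ->. Qed.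

Hypothesis dM : derivation d.

Lemma derivation_map_poly : derivation (map_poly d).
Proof.
move=> p q; apply/polyP => k.
rewrite coefD coef_map !coefM raddf_sum -big_split /=.
by apply: eq_bigr => i _; rewrite dM !coef_map.
Qed.

(** The product of two solutions is a solution because [d/dt] and the
    coefficientwise [d] are both derivations. *)
Lemma flowM (p q : {poly R}) : flow d p -> flow d q -> flow d (p * q).
Proof. by rewrite /flow derivM derivation_map_poly => -> ->. Qed.

End Flow.

(** * Induction over the ring operations *)

Lemma mpoly_ring_ind (m : nat) (R : nzRingType) (P : {mpoly R[m]} -> Prop) :
    (forall c, P c%:MP) -> (forall i, P 'X_i) ->
    (forall p q, P p -> P q -> P (p + q)) ->
    (forall p q, P p -> P q -> P (p * q)) ->
  forall p, P p.
Proof.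
move=> PC PX PD PM; elim/mpolyind => [|c u p _ _ Pp].
  by rewrite -(mpolyC0 m R); apply: PC.
apply: PD => //; rewrite -mul_mpolyC; apply: (PM) => //.
rewrite mpolyXE_id; apply: big_ind => [|v w|i _]; [exact: PC 1 | exact: PM |].
by elim: (u i) => [|k IHk]; [exact: PC 1 | rewrite exprS; apply: PM].
Qed.

(** * The operator [D] *)

Lemma D_is_zmod_morphism (n : nat) : zmod_morphism (@D n).
Proof.
move=> p q; rewrite /D -sumrB; apply: eq_bigr => i _.
by rewrite mderivB mulrBr scalerBr.
Qed.

HB.instance Definition _ (n : nat) :=
  GRing.isZmodMorphism.Build _ _ (@D n) (@D_is_zmod_morphism n).

Lemma D_derivation (n : nat) : derivation (@D n).
Proof.
move=> p q; rewrite /D mulr_suml mulr_sumr -big_split; apply: eq_bigr => i _ /=.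
by rewrite mderivM mulrDr scalerDr -scalerAl -scalerAr !mulrA [p * _]mulrC.
Qed.

Lemma D_const (n : nat) (c : rat) : D c%:MP_[n.+1] = 0.
Proof. by rewrite /D big1 // => i _; rewrite mderivC mulr0 scaler0. Qed.

(** The uniform formula [D a_i = i a_(i-1)] also covers [i = 0], where the
    factor [i] makes the value of [i.-1] irrelevant. *)
Lemma D_var (n i : nat) :
  (i <= n)%N -> D ('X_(inord i) : {mpoly rat[n.+1]}) = 'X_(inord i.-1) *+ i.
Proof.
case: i => [|i] le_i_n.
  rewrite mulr0n /D big1 // => j _; rewrite mderivX mnm1E.
  by rewrite -val_eqE /= inordK // scale0r mulr0 scaler0.
rewrite /D (bigD1 (Ordinal le_i_n)) //= big1 => [|j ne_j_i].
  rewrite addr0 scaler_nat; congr (_ *+ _).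
  have -> : lift ord0 (Ordinal le_i_n) = inord i.+1.
    by apply: val_inj; rewrite /= inordK.
  rewrite mderivX mnm1E eqxx scale1r.
  have -> : (U_(inord i.+1) - U_(inord i.+1) = 0 :> 'X_{1.. n.+1})%MM.
    by apply/mnmP => j; rewrite mnmBE subnn mnm0E.
  rewrite mpolyX0 mulr1; congr 'X_(_).
  by apply: val_inj; rewrite /= inordK // ltnW.
rewrite mderivX mnm1E -val_eqE /= inordK // /bump add1n eqSS.
by rewrite eq_sym -val_eqE in ne_j_i; rewrite (negPf ne_j_i) scale0r mulr0 scaler0.
Qed.

(** * The shear as a flow *)

(** The polynomial in [t] which becomes [a_i'] at [t = z]. *)
Definition shear_poly (n i : nat) : {poly {mpoly rat[n.+1]}} :=
  \poly_(k < i.+1) ('X_(inord (i - k)) *+ 'C(i, k)).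

Lemma coef_shear_poly (n i k : nat) :
  (shear_poly n i)`_k = 'X_(inord (i - k)) *+ 'C(i, k).
Proof. by rewrite coef_poly ltnS; case: leqP => // /bin_small->. Qed.

Lemma flow_shear_poly (n i : nat) : (i <= n)%N -> flow (@D n) (shear_poly n i).
Proof.
move=> le_i_n; apply/flowP => k; rewrite !coef_shear_poly raddfMn /=.
rewrite D_var ?(leq_trans (leq_subr _ _)) // -!mulrnA subnS.
by rewrite -mul_bin_left mulnC.
Qed.

Definition eval_z (n : nat) (q : {poly {mpoly rat[n.+1]}}) :
  {mpoly rat[n.+2]} := (map_poly (@mwiden _ _) q).[zvar n].

Lemma eval_zE (n : nat) (q : {poly {mpoly rat[n.+1]}}) :
  eval_z q = \sum_(k < size q) mwiden q`_k * zvar n ^+ k.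
Proof.
rewrite /eval_z (horner_coef_wide _ (size_poly _ _)).
by apply: eq_bigr => k _; rewrite coef_map.
Qed.

Lemma mwiden_var (n : nat) (i : 'I_n.+1) : mwiden 'X_i = avar i.
Proof. by rewrite mwidenX mnmwiden1. Qed.

Lemma eval_z_shear_poly (n : nat) (i : 'I_n.+1) :
  eval_z (shear_poly n i) = ashear i.
Proof.
rewrite /eval_z (@horner_coef_wide _ i.+1); last first.
  by rewrite (leq_trans (size_poly _ _)) // size_poly.
apply: eq_bigr => k _; rewrite coef_map coef_shear_poly /= mwidenMn mwiden_var.
by rewrite scaler_nat mulrnAl.
Qed.

(** Ring-theoretic induction on [I]: every condition on [q] passes to sums and
    products. *)
Lemma flow_exists (n : nat) (I : {mpoly rat[n.+1]}) :
  exists q : {poly {mpoly rat[n.+1]}},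
    [/\ q`_0 = I, flow (@D n) q &
        eval_z q = I \mPo [tuple ashear i | i < n.+1]].
Proof.
elim/mpoly_ring_ind: I => [c|i|p q|p q].
- exists c%:MP%:P; split; first by rewrite coefC.
    by rewrite /flow derivC map_polyC /= D_const.
  by rewrite /eval_z map_polyC /= hornerC mwidenC comp_mpolyC.
- exists (shear_poly n i); split.
  + by rewrite coef_shear_poly subn0 bin0 inord_val.
  + by apply: flow_shear_poly; rewrite -ltnS.
  + by rewrite eval_z_shear_poly comp_mpolyXU -tnth_nth tnth_mktuple.
- case=> u [<- fu eu] [v [<- fv ev]]; exists (u + v); split.
  + by rewrite coefD.
  + exact: flowD.
  + by rewrite [RHS]rmorphD /= -eu -ev /eval_z rmorphD hornerD.
- case=> u [<- fu eu] [v [<- fv ev]]; exists (u * v); split.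
  + by rewrite coef0M.
  + exact: (flowM (@D_derivation n)).
  + by rewrite [RHS]rmorphM /= -eu -ev /eval_z rmorphM hornerM.
Qed.

Theorem theorem2p1 (n : nat) (I : {mpoly rat[n.+1]}) :
  exists N : nat,
    (forall i : nat, (N <= i)%N -> iter i (@D n) I = 0) /\
    I \mPo [tuple ashear i | i < n.+1] =
      \sum_(i < N) (i`!%:R)^-1 *: (mwiden (iter i (@D n) I) * zvar n ^+ i).
Proof.
have [q [<- fq <-]] := flow_exists I.
exists (size q); split=> [i le_q_i|].
  by rewrite (flow_coef fq) nth_default // mul0rn.
rewrite eval_zE; apply: eq_bigr => i _.
rewrite (flow_coef fq) mwidenMn mulrnAl -scaler_nat scalerA mulVf ?scale1r //.
by rewrite Num.Theory.pnatr_eq0 -lt0n fact_gt0.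
Qed.
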